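(* Let $V=\{1,\dots,n\}$ with $n\ge1$, let $f:2^V\to\mathbb{R}_+$ be a non-decreasing submodular function with $f(\emptyset)=0$, let $w\in\mathbb{R}^n$ have all $w_i>0$, and let $\zeta\in\mathbb{R}^n$ have all $\zeta_i>0$. Suppose the payoff $P_{f,w}$ is $\zeta$-decreasing. Let $\mathcal{F}$ be the family of non-empty sets $S\subseteq V$ that minimize $f(S)/w^{-1}(S)$ over non-empty subsets of $V$. Then $S^*=\bigcup_{S\in\mathcal{F}}S$ is equal to $\{i\in V:\zeta_i\le r\}$ for some $r>0$.
   Context: For $S\subseteq V$, $w^{-1}(S)=\sum_{i\in S}1/w_i$. For a permutation $\sigma$ of $V$, the point $x^\sigma\in\mathbb{R}^n$ is given by $x^\sigma_{\sigma(j)}=f(\{\sigma(1),\dots,\sigma(j)\})-f(\{\sigma(1),\dots,\sigma(j-1)\})$, $j=1,\dots,n$, and the payoff function is $P_{f,w}(\sigma,j)=w_jx^\sigma_j$ for $j\in V$. The payoff $P=P_{f,w}$ is $\zeta$-decreasing if for any permutation $\sigma$ of $V$ and any $i,j\in V$ with $\sigma^{-1}(i)<\sigma^{-1}(j)$ (i.e. $i$ precedes $j$ in $\sigma$), $\frac{P(\sigma,i)}{P(\sigma,j)}\ge\frac{\zeta_i}{\zeta_j}$, understood in the cross-multiplied form $\zeta_jP(\sigma,i)\ge\zeta_iP(\sigma,j)$. *)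

(* Defs.v *)
From HB Require Import structures.
From mathcomp Require Import all_boot all_order all_algebra all_fingroup.
From mathcomp Require Import reals.

Set Implicit Arguments.
Unset Strict Implicit.
Unset Printing Implicit Defensive.

Import Order.TTheory GRing.Theory Num.Theory.
Local Open Scope ring_scope.

(* The ground set V = {1, ..., n} is 'I_n, i.e. shifted to 0, ..., n-1.
   Positions are shifted in the same way: position j (counted from 0) has
   preceding elements prefix_set s j and, with itself, prefix_set s j.+1. *)

Definition nondecreasing_set_fun (R : realType) (n : nat)
    (f : {set 'I_n} -> R) : Prop :=
  forall S T : {set 'I_n}, S \subset T -> f S <= f T.

Definition submodular (R : realType) (n : nat) (f : {set 'I_n} -> R) : Prop :=
  forall S T : {set 'I_n}, f (S :|: T) + f (S :&: T) <= f S + f T.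

Definition winv (R : realType) (n : nat) (w : 'rV[R]_n) (S : {set 'I_n}) : R :=
  \sum_(i in S) 1 / w 0 i.

(* A permutation s sends positions to elements: s j is the element in position
   j, and (s^-1)%g i is the position of the element i. *)
Definition prefix_set (n : nat) (s : 'S_n) (k : nat) : {set 'I_n} :=
  [set s j | j : 'I_n & (j < k)%N].

Definition xperm (R : realType) (n : nat) (f : {set 'I_n} -> R) (s : 'S_n) :
    'rV[R]_n :=
  \row_i (f (prefix_set s ((s^-1)%g i).+1) - f (prefix_set s ((s^-1)%g i))).

Lemma xperm_at (R : realType) (n : nat) (f : {set 'I_n} -> R) (s : 'S_n)
    (j : 'I_n) :
  xperm f s 0 (s j) = f (prefix_set s j.+1) - f (prefix_set s j).
Proof. by rewrite mxE permK. Qed.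

Definition payoff (R : realType) (n : nat) (f : {set 'I_n} -> R)
    (w : 'rV[R]_n) (s : 'S_n) (j : 'I_n) : R :=
  w 0 j * xperm f s 0 j.

Definition zeta_decreasing (R : realType) (n : nat) (zeta : 'rV[R]_n)
    (P : 'S_n -> 'I_n -> R) : Prop :=
  forall (s : 'S_n) (i j : 'I_n), ((s^-1)%g i < (s^-1)%g j)%N ->
    zeta 0 j * P s i >= zeta 0 i * P s j.

Definition ratio_minimizers (R : realType) (n : nat) (f : {set 'I_n} -> R)
    (w : 'rV[R]_n) : {set {set 'I_n}} :=
  [set S : {set 'I_n} | (S != set0) &&
    [forall T : {set 'I_n}, (T != set0) ==>
       (f S / winv w S <= f T / winv w T)]].

(* Main.v *)
Require Import Defs.
From HB Require Import structures.
From mathcomp Require Import all_boot all_order all_algebra all_fingroup.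
From mathcomp Require Import reals.
From mathcomp Require Import lra.

Set Implicit Arguments.
Unset Strict Implicit.
Unset Printing Implicit Defensive.

Import Order.TTheory GRing.Theory Num.Theory.
Local Open Scope ring_scope.

(** Let rho be the minimum of f(S) / w^-1(S). The function
    g(S) = f(S) - rho w^-1(S) is submodular, nonnegative and zero at the empty
    set, and the minimizing sets are exactly its non-empty zeros. Zeros of a
    nonnegative submodular function are closed under union
    ([bound_tight_bigcup]), so the union U of all minimizers is the largest
    zero of g.

    It suffices that zeta i < zeta j whenever i is in U and j is
    not: one then takes r to be the maximum of zeta over U. To compare i and j,
    order V so that U \ {i} comes first, then i, then j
    ([exists_perm_two_steps]). Adding i goes from g(U \ {i}) >= 0 to
    g(U) = 0, so the payoff of i is at most rho. Adding j leaves the largest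
    zero, so g becomes positive and the payoff of j exceeds rho. The payoff
    thus increases strictly from i to j, and the payoff being zeta-decreasing allows this only
    if zeta i < zeta j. *)

(** Permutations are easiest to prescribe by listing the elements in order. *)
Lemma exists_perm_of_seq (n : nat) (l : seq 'I_n) :
  size l = n -> (forall x, x \in l) ->
  exists s : 'S_n,
    (forall x, (s^-1)%g x = index x l :> nat) /\
    (forall k, prefix_set s k = [set x in take k l]).
Proof.
move=> size_l l_full.
have index_lt x : (index x l < n)%N by rewrite -[X in (_ < X)%N]size_l index_mem.
have index_inj : injective (fun x => Ordinal (index_lt x)).
  by move=> x y [/(index_inj x) ->].
have pos x : (((perm index_inj)^-1)^-1)%g x = index x l :> nat.
  by rewrite invgK permE.
exists ((perm index_inj)^-1)%g; split=> // k; apply/setP=> x.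
rewrite inE in_take // -pos; apply/imsetP/idP => [[j + ->]|ltk].
  by rewrite inE permK.
by exists ((((perm index_inj)^-1)^-1)%g x); rewrite ?inE ?permKV.
Qed.

Lemma exists_perm_two_steps (n : nat) (A : {set 'I_n}) (i j : 'I_n) :
  i \notin A -> j \notin i |: A ->
  exists s : 'S_n,
    [/\ ((s^-1)%g i < (s^-1)%g j)%N,
        prefix_set s ((s^-1)%g i) = A,
        prefix_set s ((s^-1)%g i).+1 = i |: A,
        prefix_set s ((s^-1)%g j) = i |: A &
        prefix_set s ((s^-1)%g j).+1 = j |: (i |: A)].
Proof.
move=> iA jiA; have := jiA; rewrite !inE negb_or => /andP[ji jA].
pose l := enum A ++ i :: j :: enum (~: (j |: (i |: A))).
have size_l : size l = n.
  rewrite size_cat /= -!cardE -[RHS]card_ord -(cardsC (j |: (i |: A))).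
  by rewrite !cardsU1 iA jiA; rewrite !add1n !addSn !addnS.
have l_full x : x \in l.
  rewrite mem_cat !inE !mem_enum !inE.
  by case: (x \in A); case: (x == i); case: (x == j).
have [s [pos pre]] := exists_perm_of_seq size_l l_full.
have pos_i : (s^-1)%g i = #|A| :> nat.
  by rewrite pos index_cat mem_enum (negbTE iA) /= eqxx addn0 cardE.
have pos_j : (s^-1)%g j = #|A|.+1 :> nat.
  rewrite pos index_cat mem_enum (negbTE jA) /= eqxx eq_sym (negbTE ji).
  by rewrite addn1 cardE.
have take_l k : take (#|A| + k) l =
    enum A ++ take k (i :: j :: enum (~: (j |: (i |: A)))).
  by rewrite take_cat -cardE ltnNge leq_addr /= addKn.
have := take_l 0; have := take_l 1; have := take_l 2.
rewrite addn2 addn1 addn0 /= => take2 take1 take0_.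
exists s; rewrite pos_i pos_j !pre take2 take1 take0_; split=> //.
all: apply/setP=> x; rewrite !inE mem_cat mem_enum ?inE ?take0 ?orbF //=.
all: by case: (x \in A); case: (x == i); case: (x == j).
Qed.

Section TightSets.
Variables (R : realType) (n : nat) (f : {set 'I_n} -> R) (w : 'rV[R]_n).

Lemma winv_setU_setI (S T : {set 'I_n}) :
  winv w (S :|: T) + winv w (S :&: T) = winv w S + winv w T.
Proof.
rewrite /winv !(big_mkcond (fun k => k \in _)) -!big_split /=.
apply: eq_bigr => k _; rewrite !inE.
by case: (k \in S); case: (k \in T) => //=; rewrite addrC.
Qed.

Lemma winv_setU1 (i : 'I_n) (S : {set 'I_n}) :
  i \notin S -> winv w (i |: S) = 1 / w 0 i + winv w S.
Proof. by move=> iS; rewrite /winv big_setU1. Qed.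

Lemma winv_gt0 (S : {set 'I_n}) :
  (forall i, 0 < w 0 i) -> S != set0 -> 0 < winv w S.
Proof.
move=> w_gt0 /set0Pn[i iS]; rewrite /winv (bigD1 i) //=.
rewrite ltr_pwDl ?divr_gt0 ?sumr_ge0 // => j _.
by rewrite divr_ge0 // ltW.
Qed.

(** Sets where the lower bound [rho * winv w] of a submodular function is
    attained are closed under union: submodularity forces the sum of the two
    nonnegative gaps at the union and the intersection to be at most zero. *)
Lemma bound_tight_setU (rho : R) (S T : {set 'I_n}) :
  submodular f -> (forall U, rho * winv w U <= f U) ->
  f S = rho * winv w S -> f T = rho * winv w T ->
  f (S :|: T) = rho * winv w (S :|: T).
Proof.
move=> f_submod bound tightS tightT.
have := f_submod S T; rewrite tightS tightT -mulrDr -winv_setU_setI mulrDr.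
have := bound (S :|: T); have := bound (S :&: T); lra.
Qed.

Lemma bound_tight_bigcup (rho : R) (F : {set {set 'I_n}}) :
  f set0 = 0 -> submodular f -> (forall U, rho * winv w U <= f U) ->
  (forall S, S \in F -> f S = rho * winv w S) ->
  f (\bigcup_(S in F) S) = rho * winv w (\bigcup_(S in F) S).
Proof.
move=> f_set0 f_submod bound tightF.
apply: (big_ind (fun U => f U = rho * winv w U)) => //.
- by rewrite f_set0 /winv big_set0 mulr0.
- by move=> S T; apply: bound_tight_setU.
Qed.

(** The minimum ratio turns the fractional minimization into a linear lower
    bound on f, whose non-empty equality cases are the minimizers. *)
Lemma exists_min_ratio :
  (0 < n)%N -> (forall i, 0 < w 0 i) -> (forall S, 0 <= f S) -> f set0 = 0 ->
  exists rho : R,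
    [/\ 0 <= rho, forall T, rho * winv w T <= f T,
        ratio_minimizers f w != set0 &
        forall T, (T \in ratio_minimizers f w) =
                  (T != set0) && (f T == rho * winv w T)].
Proof.
move=> n_gt0 w_gt0 f_ge0 f_set0.
have setT_neq0 : [set: 'I_n] != set0.
  by apply/set0Pn; exists (Ordinal n_gt0); rewrite inE.
have [M M_neq0 M_min] := @arg_minP _ _ _ _ (fun S => S != set0)
  (fun S => f S / winv w S) setT_neq0.
have bound T : f M / winv w M * winv w T <= f T.
  have [->|T_neq0] := eqVneq T set0; first by rewrite f_set0 /winv big_set0 mulr0.
  by rewrite -ler_pdivlMr ?winv_gt0 // M_min.
exists (f M / winv w M); split=> //.
- by rewrite divr_ge0 // ltW // winv_gt0.
- apply/set0Pn; exists M; rewrite inE M_neq0 /=.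
  by apply/forallP=> T; apply/implyP=> /M_min.
- move=> T; rewrite inE; have [T_neq0|//] := boolP (T != set0).
  rewrite /= eq_le bound andbT -ler_pdivrMr ?winv_gt0 //.
  apply/forallP/idP => [/(_ M)/implyP/(_ M_neq0) //|leM U].
  by apply/implyP=> /M_min; apply: le_trans.
Qed.

End TightSets.

(** The exchange step. Put i last among the elements of a tight set S, and j
    right after S. Tightness at S bounds the payoff of i by rho, and the strict
    inequality at [j |: S] makes the payoff of j exceed rho. *)
Lemma zeta_lt_of_tight (R : realType) (n : nat) (f : {set 'I_n} -> R)
    (w zeta : 'rV[R]_n) (rho : R) (S : {set 'I_n}) (i j : 'I_n) :
  (forall k, 0 < w 0 k) -> (forall k, 0 < zeta 0 k) ->
  zeta_decreasing zeta (payoff f w) ->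
  0 <= rho -> (forall T, rho * winv w T <= f T) ->
  f S = rho * winv w S ->
  i \in S -> j \notin S -> rho * winv w (j |: S) < f (j |: S) ->
  zeta 0 i < zeta 0 j.
Proof.
move=> w_gt0 zeta_gt0 decr rho_ge0 bound tightS iS jS gap.
have iSi : i \notin S :\ i by rewrite !inE eqxx.
have Si : i |: (S :\ i) = S by rewrite setD1K.
have jSi : j \notin i |: (S :\ i) by rewrite Si.
have [s [lt_ij pre_i pre_iS pre_j pre_jS]] := exists_perm_two_steps iSi jSi.
have := decr s i j lt_ij.
rewrite /payoff !mxE pre_i pre_iS pre_j pre_jS Si => decr_ij.
have payoff_i : w 0 i * (f S - f (S :\ i)) <= rho.
  have := bound (S :\ i).
  rewrite -(ler_pdivlMl _ _ (w_gt0 i)) [_^-1 * _]mulrC.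
  rewrite tightS -{3}Si winv_setU1 // mul1r mulrDr.
  lra.
have payoff_j : rho < w 0 j * (f (j |: S) - f S).
  move: gap; rewrite -(ltr_pdivrMl _ _ (w_gt0 j)) [_^-1 * _]mulrC.
  rewrite tightS winv_setU1 // mul1r mulrDr.
  lra.
(* Multiplying by rho, which may be zero, is enough: the inequality obtained
   is strict, so it fails when zeta 0 j <= zeta 0 i. *)
have : zeta 0 i * rho < zeta 0 j * rho.
  apply: lt_le_trans (_ : zeta 0 i * (w 0 j * (f (j |: S) - f S)) <= _).
    by rewrite ltr_pM2l.
  by apply: le_trans decr_ij _; rewrite ler_pM2l.
by apply: contraTT; rewrite -!leNgt => /ler_wpM2r; apply.
Qed.

Theorem lemma7 (R : realType) (n : nat) (hn : (1 <= n)%N)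
    (f : {set 'I_n} -> R)
    (f_ge0 : forall S : {set 'I_n}, 0 <= f S)
    (f_mono : nondecreasing_set_fun f)
    (f_submod : submodular f)
    (f_set0 : f set0 = 0)
    (w : 'rV[R]_n) (w_gt0 : forall i : 'I_n, 0 < w 0 i)
    (zeta : 'rV[R]_n) (zeta_gt0 : forall i : 'I_n, 0 < zeta 0 i)
    (payoff_decr : zeta_decreasing zeta (payoff f w)) :
  exists r : R, 0 < r /\
    \bigcup_(S in ratio_minimizers f w) S = [set i : 'I_n | zeta 0 i <= r].
Proof.
have [rho [rho_ge0 bound F_neq0 memF]] := exists_min_ratio hn w_gt0 f_ge0 f_set0.
set Sstar := \bigcup_(S in _) S.
have tight : f Sstar = rho * winv w Sstar.
  apply: bound_tight_bigcup => // S; rewrite memF => /andP[_ /eqP //].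
have [i0 i0S] : exists i0, i0 \in Sstar.
  have [M MF] := set0Pn _ F_neq0.
  have : M != set0 by move: MF; rewrite memF => /andP[].
  by move=> /set0Pn[i0 i0M]; exists i0; apply/bigcupP; exists M.
have zeta_lt i j : i \in Sstar -> j \notin Sstar -> zeta 0 i < zeta 0 j.
  move=> iS jS; apply: (zeta_lt_of_tight _ _ payoff_decr rho_ge0 bound tight) => //.
  rewrite lt_neqAle bound andbT eq_sym; apply: contra jS => tight_j.
  apply/bigcupP; exists (j |: Sstar); last exact: setU11.
  by rewrite memF tight_j andbT; apply/set0Pn; exists j; exact: setU11.
have [m mS m_max] :=
  @arg_maxP _ _ _ i0 (fun i => i \in Sstar) (fun i => zeta 0 i) i0S.
exists (zeta 0 m); split=> //; apply/setP=> i; rewrite inE.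
have [iS|iS] := boolP (i \in Sstar).
  by apply/esym; apply: m_max.
by rewrite leNgt zeta_lt.
Qed.
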